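(* Let $n\ge 1$, let $\lambda=(n,n-1,\ldots,1,0)$, let $GZ^A_\lambda$ be the Gelfand--Zetlin polytope of type $A_n$, let $v$ be its Kogan vertex, and let $i\in\{1,\ldots,n\}$. Let $F\subset GZ^A_\lambda$ be a Kogan face whose diagram $D(F)$ has $+$ in cell $(1,i)$ and has no $+$ in any cell $(j,i+1)$. Then the geometric mitosis $\mathcal M^v_i(F)$ consists of exactly those Kogan faces whose diagrams belong to the set $M^A_i(D(F))$ obtained from $D(F)$ by the combinatorial mitosis operation $M^A_i$ on GZ tables.
   Context: Put $\lambda_j:=n+1-j$ for $j=1,\ldots,n+1$ and $d=n(n+1)/2$. Coordinates on $\mathbb R^d$ are $x^i_j$ for $1\le i\le n$, $1\le j\le n-i+1$; set $x^0_j:=\lambda_j$. The GZ polytope $GZ^A_\lambda\subset\mathbb R^d$ is defined by the inequalities $x^{i-1}_j\ge x^i_j\ge x^{i-1}_{j+1}$ for all $1\le i\le n$, $1\le j\le n-i+1$. Write $A_{i,j}$ for the equation $x^{i-1}_j=x^i_j$ and $B_{i,j}$ for the equation $x^i_j=x^{i-1}_{j+1}$. The Kogan vertex $v$ is the unique point of $GZ^A_\lambda$ satisfying all equations $A_{i,j}$. A Kogan face is a face of $GZ^A_\lambda$ containing $v$; each Kogan face is the set of points of $GZ^A_\lambda$ satisfying some collection of equations $A_{i,j}$. A GZ table is the set of cells $(i,j)$, $1\le i\le n$, $1\le j\le n-i+1$ (cell $(i,j)$ is the $j$-th cell of row $i$), some of which are filled with $+$. The diagram $D(F)$ of a Kogan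 face $F$ is the GZ table with $+$ in cell $(i,j)$ iff $F$ satisfies $A_{i,j}$. Geometric mitosis: let $\Delta$ be a polytope, $P,Q$ faces of $\Delta$ and $v\in P$ a vertex. A face $F\subset P$ is admissible if there is a unique face $\exp(F)\neq F$ of $\Delta$ with $\exp(F)\cap P=F$. For an admissible face $F\ni v$, its set of offsprings $\mathcal M^v(F)$ is the set of faces $E$ of $\Delta$ with $v\in E$, $\dim E=\dim F+1$, $E\not\subset P$, $E\not\subset Q$, and $E\cap Q\subseteq \exp(F)\cap Q$. Here $\mathcal M^v_i$ denotes this operation for $\Delta=GZ^A_\lambda$, $P=P_i:=\{x^1_i=\lambda_i\}\cap GZ^A_\lambda$, $Q=Q_i:=\{x^1_i=\lambda_{i+1}\}\cap GZ^A_\lambda$ (for this $\lambda$, $GZ^A_\lambda$ is, up to translation, the Cayley sum of $P_i$ and $Q_i$). Combinatorial mitosis $M^A_i$ on a GZ table $D$: put $\ell=n-i$, label cells $a_k:=(k,i)$ for $k=1,\ldots,\ell+1$ and $b_k:=(k,i+1)$ for $k=1,\ldots,\ell$. If $a_1$ is empty, $M^A_i(D)=\varnothing$. Otherwise let $r$ be maximal such that $a_1,\ldots,a_r$ all contain $+$, and let $\mathcal J=\{j\le r:\ b_j \text{ is empty or } j=\ell+1\}$. For each $p\in\mathcal J$ the table $D_p$ is obtained from $D$ by erasing the $+$ in $a_p$ and, for every $j\in\mathcal J$ with $j<p$, moving the $+$ from $a_j$ to $b_j$; all other cells are unchanged. Then $M^A_i(D)=\{D_p: p\in\mathcal J\}$.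 *)

(* Defs.v *)
From HB Require Import structures.
From mathcomp Require Import all_boot all_order all_algebra.
From mathcomp Require Import boolp classical_sets reals.
From mathcomp Require Import zify.

Set Implicit Arguments.
Unset Strict Implicit.
Unset Printing Implicit Defensive.

Import Order.TTheory GRing.Theory Num.Theory.

Local Open Scope classical_set_scope.
Local Open Scope ring_scope.

Section Faces.
Variables (R : realType) (V : vectType R).
Implicit Types (Delta P Q F G E : set V) (v : V).

(* [f = 0] yields both [Delta] itself and the empty face. *)
Definition face Delta F :=
  exists (f : {scalar V}) (b : R),
    (forall x, Delta x -> f x <= b) /\ F = [set x | Delta x /\ f x = b].

(* The largest k such that S contains k + 1 affinely independent points
   x0, x0 + t_1, ..., x0 + t_k (junk value 0 on the empty set). *)
Definition affdim (S : set V) : nat :=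
  \max_(k < (\dim {:V}).+1 |
      `[< exists (x0 : V) (t : k.-tuple V),
            [/\ S x0, forall u, u \in t -> S (x0 + u) & free t] >]) k.

Definition is_exp Delta P F G := [/\ face Delta G, G <> F & G `&` P = F].

Definition admissible Delta P F :=
  [/\ face Delta F, F `<=` P & exists! G, is_exp Delta P F G].

(* Meaningful for admissible F only. *)
Definition exp_face Delta P F : set V := xget set0 [set G | is_exp Delta P F G].

Definition geom_mitosis Delta P Q v F : set (set V) :=
  [set E | [/\ face Delta E /\ E v,
               affdim E = (affdim F).+1,
               ~ (E `<=` P),
               ~ (E `<=` Q) &
               E `&` Q `<=` exp_face Delta P F `&` Q]].

End Faces.

Definition cells (n : nat) : seq (nat * nat) :=
  [seq (i, j) | i <- iota 1 n, j <- iota 1 (n - i + 1)]%N.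

Notation cell n := (seq_sub (cells n)).

Notation gzpoint R n := {ffun cell n -> R^o}.

Section GelfandZetlin.
Variables (R : realType) (n : nat).

Local Notation gzpoint := (gzpoint R n).

Definition lambda (j : nat) : R := (n + 1 - j)%N%:R.

(* x^i_j, with x^0_j = lambda_j (junk value 0 outside the table). *)
Definition coord (x : gzpoint) (i j : nat) : R :=
  if i == 0%N then lambda j
  else if insub (i, j) is Some c then x c else 0.

Definition GZ : set gzpoint :=
  [set x | forall i j, (i, j) \in cells n ->
     coord x i j <= coord x (i - 1)%N j /\ coord x (i - 1)%N (j + 1)%N <= coord x i j].

Definition eqA (i j : nat) (x : gzpoint) : Prop := coord x (i - 1)%N j = coord x i j.

Definition kogan_vertex (v : gzpoint) : Prop :=
  GZ v /\ forall i j, (i, j) \in cells n -> eqA i j v.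

Definition kogan_face (v : gzpoint) (F : set gzpoint) : Prop := face GZ F /\ F v.

Definition diagram (F : set gzpoint) : {set cell n} :=
  [set c : cell n | `[< forall x, F x -> eqA (val c).1 (val c).2 x >]]%SET.

Definition Pface (i : nat) : set gzpoint := GZ `&` [set x | coord x 1 i = lambda i].

Definition Qface (i : nat) : set gzpoint :=
  GZ `&` [set x | coord x 1 i = lambda (i + 1)%N].

Definition GZ_mitosis (v : gzpoint) (i : nat) (F : set gzpoint) : set (set gzpoint) :=
  geom_mitosis GZ (Pface i) (Qface i) v F.

End GelfandZetlin.

Arguments GZ R n : clear implicits.
Arguments Pface R n i : clear implicits.
Arguments Qface R n i : clear implicits.

Section Tables.
Variable n : nat.
Implicit Types (D : {set cell n}) (i p : nat).

(* False when (i, j) is not a cell. *)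
Definition has_plus D i j : bool :=
  if insub (i, j) is Some c then (c : cell n) \in D else false.

Definition mit_r D i : nat :=
  \max_(k < (n - i).+2 | all (fun j => has_plus D j i) (iota 1 k)) k.

Definition mit_J D i : seq nat :=
  [seq j <- iota 1 (mit_r D i) | ~~ has_plus D j (i + 1)%N || (j == (n - i).+1)].

Definition mit_table D i p : {set cell n} :=
  let moved j := (j \in mit_J D i) && (j < p)%N in
  (D :\: [set c : cell n | ((val c).2 == i) &&
                           (((val c).1 == p) || moved (val c).1)]
     :|: [set c : cell n | ((val c).2 == (i + 1)%N) && moved (val c).1])%SET.

Definition comb_mitosis D i : {set {set cell n}} :=
  (if has_plus D 1 i then [set:: [seq mit_table D i p | p <- mit_J D i]]
   else finset.set0)%SET.

End Tables.

Section KoganVertex.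
Variables (R : realType) (n : nat).

Lemma mem_cells (i j : nat) :
  ((i, j) \in cells n) = (0 < i <= n)%N && (0 < j <= n - i + 1)%N.
Proof.
apply/allpairsPdep/andP => [[a [b []]]|[ai bi]].
  by rewrite !mem_iota => ha hb [-> ->]; split; lia.
by exists i, j; rewrite !mem_iota; split=> //; lia.
Qed.

Lemma coord_cell (x : gzpoint R n) (c : cell n) :
  coord x (val c).1 (val c).2 = x c.
Proof.
rewrite /coord; case: eqP => [h|_]; last by rewrite -surjective_pairing valK.
by have := valP c; rewrite [val c]surjective_pairing mem_cells h.
Qed.

Lemma kogan_vertex_exists_unique : exists! v : gzpoint R n, kogan_vertex v.
Proof.
pose v : gzpoint R n := [ffun c : cell n => lambda R n (val c).2].
have vE (i j : nat) : (i == 0%N) || ((i, j) \in cells n) -> coord v i j = lambda R n j.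
  rewrite /coord; case: eqP => //= _ h.
  by rewrite insubT ffunE.
have pred_cell (i j : nat) : (i, j) \in cells n ->
    ((i - 1)%N == 0%N) || (((i - 1)%N, j) \in cells n).
  by rewrite !mem_cells; lia.
have pred_cell1 (i j : nat) : (i, j) \in cells n ->
    ((i - 1)%N == 0%N) || (((i - 1)%N, (j + 1)%N) \in cells n).
  by rewrite !mem_cells; lia.
exists v; split.
  split=> i j h; last by rewrite /eqA (vE _ _ (pred_cell _ _ h)) vE ?h ?orbT.
  rewrite (vE _ _ (pred_cell _ _ h)) (vE _ _ (pred_cell1 _ _ h)).
  rewrite vE ?h ?orbT //; split=> //.
  by rewrite /lambda ler_nat; lia.
move=> w [_ hw]; apply/ffunP => c; rewrite ffunE -coord_cell.
have := valP c; rewrite {1}[val c]surjective_pairing.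
move: (val c).1 (val c).2 => i j; elim: i => [|i IHi] h.
  by rewrite mem_cells in h.
have := hw _ _ h; rewrite /eqA subn1 /= => <-.
have := pred_cell _ _ h; rewrite subn1 /= => /orP[/eqP ->//|].
exact: IHi.
Qed.

End KoganVertex.

(* Main.v *)
(** At the Kogan vertex exactly the inequalities A are tight, and the gaps
    [x^(i-1)_j - x^i_j] form a linear coordinate system; hence Kogan faces
    correspond to arbitrary sets D of cells and have codimension #|D|, and
    the exp of the face of D is the face of [D :\ a_1].

    On [Q_i], column [i] starts at [lambda_(i+1)] and dominates column [i + 1]
    with a shift of one row, so if [b_1, ..., b_m] (with m maximal) belong to
    the table D' of a face E, then [a_2, ..., a_(m+1)] are forced on
    [E `&` Q_i]; explicit lattice points show that nothing else is.  Thus E is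
    an offspring iff [#|D'| = #|D| - 1], [a_1] is not in D' and [D :\: D'] is
    contained in [{a_1, ..., a_(m+1)}]. As D has no b, counting forces
    [D' = D :\: {a_1, ..., a_(m+1)} :|: {b_1, ..., b_m}], that is, the table
    [D_(m+1)] of the combinatorial mitosis. *)

Require Import Defs.
From HB Require Import structures.
From mathcomp Require Import all_boot all_order all_algebra.
From mathcomp Require Import boolp classical_sets reals.
From mathcomp Require Import zify lra.

Set Implicit Arguments.
Unset Strict Implicit.
Unset Printing Implicit Defensive.

Import Order.TTheory GRing.Theory Num.Theory.

Local Open Scope classical_set_scope.

(** * Affine dimension computed from a basis of directions *)

Section AffineDimension.
Local Open Scope ring_scope.
Variables (R : realType) (V : vectType R).

Lemma size_free_le (U : {vspace V}) (t : seq V) :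
  free t -> {subset t <= U} -> (size t <= \dim U)%N.
Proof. by move=> /eqP <- /span_subvP /dimvS. Qed.

(** The family [s] is itself a candidate, which bounds the maximum from below; any competing
    independent tuple consists of differences of points of [S], so it lies in the span of [s] and is
    no longer than [s]. *)
Lemma affdim_eq (S : set V) (x0 : V) (s : seq V) :
  S x0 -> (forall u, u \in s -> S (x0 + u)) -> free s ->
  (forall x u, S x -> S (x + u) -> u \in <<s>>%VS) ->
  affdim S = size s.
Proof.
move=> Sx0 Ss fs Sspan; apply/eqP; rewrite eqn_leq; apply/andP; split.
  apply/bigmax_leqP => k /asboolP[x [t [Sx St ft]]].
  rewrite -{1}(size_tuple t) -(eqP fs); apply: size_free_le => // u ut.
  exact: Sspan Sx (St _ ut).
have hs : (size s < (\dim {:V}).+1)%N.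
  by rewrite ltnS; apply: size_free_le => // u _; exact: memvf.
apply: (@leq_bigmax_cond _ _ _ (Ordinal hs)).
by apply/asboolP; exists x0, (in_tuple s).
Qed.

End AffineDimension.

(** * Cells, tables and initial segments of columns *)

Section Cells.
Variable n : nat.
Implicit Types (c : cell n) (D : {set cell n}).

Definition crow (c : cell n) : nat := (val c).1.
Definition ccol (c : cell n) : nat := (val c).2.

Lemma cellE c : val c = (crow c, ccol c).
Proof. exact: surjective_pairing. Qed.

Lemma cellP c :
  [&& (0 < crow c)%N, (crow c <= n)%N, (0 < ccol c)%N
    & (ccol c <= n - crow c + 1)%N].
Proof.
have := valP c; rewrite {1}cellE mem_cells.
by case/andP => /andP[-> ->] /andP[-> ->].
Qed.

Lemma cell_eq c c' : crow c = crow c' -> ccol c = ccol c' -> c = c'.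
Proof.
move=> h1 h2; apply: val_inj.
by rewrite !cellE h1 h2.
Qed.

Lemma has_plusP D (k j : nat) :
  reflect (exists2 c, c \in D & val c = (k, j)) (has_plus D k j).
Proof.
rewrite /has_plus; case: insubP => [c _ hc|hn].
  apply: (iffP idP) => [cD|[c' c'D hc']]; first by exists c.
  by have -> : c = c' by apply: val_inj; rewrite hc hc'.
apply: (iffP idP) => // -[c _ hc]; have := valP c.
by rewrite {1}hc (negbTE hn).
Qed.

Lemma has_plus_cell D c : has_plus D (crow c) (ccol c) = (c \in D).
Proof. by rewrite /has_plus -cellE valK. Qed.

Definition column_prefix (j p : nat) : {set cell n} :=
  [set c : cell n | (ccol c == j) && (crow c <= p)%N]%SET.

(** Column [j] has [n + 1 - j] cells, so the bound on [p] says that it reaches row [p]. *)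
Lemma card_column_prefix (j p : nat) :
  (0 < j)%N -> (p + j <= n + 1)%N -> #|column_prefix j p| = p.
Proof.
move=> j0; elim: p => [|p IHp] hp.
  apply/eqP; rewrite cards_eq0; apply/eqP/setP => c; rewrite !inE.
  by have := cellP c; lia.
have hc : (p.+1, j) \in cells n by rewrite mem_cells; lia.
pose c0 : cell n := SeqSub hc.
have -> : column_prefix j p.+1 = (c0 |: column_prefix j p)%SET.
  apply/setP => c; rewrite !inE leq_eqVlt ltnS andb_orr.
  congr (_ || _); apply/andP/eqP => [[/eqP h2 /eqP h1]|->]; last by rewrite !eqxx.
  exact: cell_eq.
by rewrite cardsU1 !inE /= ltnn andbF IHp //; lia.
Qed.

End Cells.

(** * Gap coordinates and lattice points of the polytope *)

Section KoganFaces.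
Local Open Scope ring_scope.
Variables (R : realType) (n : nat).
Local Notation V := (gzpoint R n).
Local Notation lam := (lambda R n).
Local Notation coord := Defs.coord.
Implicit Types (c : cell n) (D : {set cell n}) (x u : V).

Definition gap c x : R :=
  coord x (crow c - 1)%N (ccol c) - coord x (crow c) (ccol c).

Lemma gap_eq0 c x : (gap c x = 0) <-> eqA (crow c) (ccol c) x.
Proof.
rewrite /gap /eqA; split=> [/eqP|->]; last by rewrite subrr.
by rewrite subr_eq0 => /eqP.
Qed.

Lemma gap_ge0 c x : GZ R n x -> 0 <= gap c x.
Proof.
move=> /(_ (crow c) (ccol c)); rewrite -cellE => /(_ (valP c))[h _].
by rewrite subr_ge0.
Qed.

(** The linear part of [coord]: row 0 reads 0 instead of the constant [lam j]. This makes [lin_gap]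
    the linear part of the affine function [gap]. *)
Definition entry k j (u : V) : R :=
  if insub (k, j) is Some c then u c else 0.

Lemma coordE x (k j : nat) : coord x k j = entry k j x + (k == 0%N)%:R * lam j.
Proof.
rewrite /coord /entry; case: eqP => [->|_]; last by rewrite mul0r addr0.
by rewrite insubN ?mem_cells // add0r mul1r.
Qed.

Lemma entry_cell c u : entry (crow c) (ccol c) u = u c.
Proof. by rewrite /entry -cellE valK. Qed.

Definition lin_gap c (u : V) : R := entry (crow c - 1)%N (ccol c) u - u c.

Lemma gapE c x :
  gap c x = lin_gap c x + ((crow c - 1)%N == 0%N)%:R * lam (ccol c).
Proof.
rewrite /gap /lin_gap !coordE entry_cell.
have -> : (crow c == 0%N) = false by have := cellP c; lia.
by rewrite mul0r addr0 addrAC.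
Qed.

Lemma entryD k j a x u : entry k j (a *: x + u) = a * entry k j x + entry k j u.
Proof.
rewrite /entry; case: insub => [c|]; first by rewrite !ffunE.
by rewrite mulr0 addr0.
Qed.

Lemma lin_gapD c a x u : lin_gap c (a *: x + u) = a * lin_gap c x + lin_gap c u.
Proof.
rewrite /lin_gap entryD.
have -> : (a *: x + u) c = a * x c + u c by rewrite !ffunE.
by rewrite mulrBr; lra.
Qed.

Lemma gap_add c x u : gap c (x + u) = gap c x + lin_gap c u.
Proof. by rewrite !gapE -[x]scale1r lin_gapD !mul1r scale1r; lra. Qed.

(* The basis of V dual to the functionals [lin_gap c]. *)
Definition tail c : V :=
  [ffun c' : cell n => - ((ccol c' == ccol c) && (crow c <= crow c')%N)%:R].

(** The sum telescopes down column [j], starting from row 0 where [entry] vanishes. *)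
Lemma sum_lin_gap u (k j : nat) :
  (k == 0%N) || ((k, j) \in cells n) ->
  \sum_(c | (ccol c == j) && (crow c <= k)%N) lin_gap c u = - entry k j u.
Proof.
elim: k => [_|k IHk /= hc].
  rewrite big1 => [|c h]; last by exfalso; have := cellP c; lia.
  by rewrite /entry insubN ?mem_cells // oppr0.
pose c0 : cell n := SeqSub hc; have rc0 : crow c0 = k.+1 by [].
rewrite (bigD1 c0) /=; last by rewrite eqxx leqnn.
rewrite (eq_bigl (fun c => (ccol c == j) && (crow c <= k)%N)); last first.
  move=> c; apply/idP/idP => [|h].
    case/andP => /andP[/eqP h2 h1] /eqP h3; rewrite h2 eqxx /=.
    rewrite leqNgt; apply/negP => h4; apply: h3; apply: cell_eq => //; lia.
  apply/andP; split; first lia.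
  by apply/eqP => h3; move: h; rewrite h3 rc0; lia.
rewrite IHk; last by move: (hc); rewrite !mem_cells; lia.
rewrite /lin_gap /crow /ccol /= subn1 /=.
have -> : entry k.+1 j u = u c0 by rewrite -entry_cell.
lra.
Qed.

Lemma tail_decomposition u : u = \sum_c lin_gap c u *: tail c.
Proof.
apply/ffunP => c0; rewrite sum_ffunE.
have := @sum_lin_gap u (crow c0) (ccol c0).
rewrite -cellE (valP c0) orbT => /(_ isT).
rewrite entry_cell => hu.
rewrite -[LHS]opprK -hu -sumrN big_mkcond /=; apply: eq_bigr => c _.
rewrite !ffunE [ccol c0 == _]eq_sym; case: ifP => _ /=; first by rewrite /GRing.scale /= mulrN1.
by rewrite oppr0 scaler0.
Qed.

(* The integral points of the table, coded by their distance [u] below the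
   Kogan vertex. *)
Definition lattice_point (u : nat -> nat -> nat) : V :=
  [ffun c : cell n => lam (ccol c + u (crow c) (ccol c))%N].

(** The interlacing inequalities translated to [lattice_point u]. At the Kogan vertex column [j + 1]
    lies one step below column [j], whence the successor in the second bound. *)
Definition lowering (u : nat -> nat -> nat) :=
  (forall j, u 0%N j = 0%N) /\
  (forall c, (u (crow c - 1) (ccol c) <= u (crow c) (ccol c)
              <= (u (crow c - 1) (ccol c + 1)).+1)%N).

Lemma coord_lattice_point (u : nat -> nat -> nat) (k j : nat) :
  (forall j, u 0%N j = 0%N) -> (k == 0%N) || ((k, j) \in cells n) ->
  coord (lattice_point u) k j = lam (j + u k j)%N.
Proof.
move=> u0; rewrite /coord; case: eqP => [-> _|_ /= h]; first by rewrite u0 addn0.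
by rewrite insubT ffunE.
Qed.

Lemma le_lambda j j' : (j <= j')%N -> lam j' <= lam j.
Proof. by move=> h; rewrite /lambda ler_nat; lia. Qed.

(** Truncated subtraction makes [lam] constant from index [n + 1] on, so injectivity stops there. *)
Lemma eq_lambda j j' : (j <= n + 1)%N -> (j' <= n + 1)%N -> lam j = lam j' -> j = j'.
Proof. by move=> h h' /eqP; rewrite /lambda eqr_nat; lia. Qed.

Lemma GZ_lattice_point (u : nat -> nat -> nat) : lowering u -> GZ R n (lattice_point u).
Proof.
move=> [u0 hu] k j hc; have := hu (SeqSub hc); rewrite /crow /ccol /= => /andP[h1 h2].
rewrite mem_cells in hc; rewrite !coord_lattice_point //;
  try by rewrite mem_cells; lia.
by split; apply: le_lambda; lia.
Qed.

Lemma eqA_lattice_point (u : nat -> nat -> nat) c :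
  (forall j, u 0%N j = 0%N) -> (ccol c + u (crow c) (ccol c) <= n + 1)%N ->
  (u (crow c - 1) (ccol c) <= u (crow c) (ccol c))%N ->
  eqA (crow c) (ccol c) (lattice_point u) <->
  u (crow c - 1)%N (ccol c) = u (crow c) (ccol c).
Proof.
move=> u0 hn hu; have := cellP c => hc.
rewrite /eqA !coord_lattice_point //; try by rewrite mem_cells; lia.
by split=> [/eq_lambda|->//]; lia.
Qed.

(** * Correspondence between tables and Kogan faces *)

Definition face_of_table D : set V :=
  GZ R n `&` [set x | forall c, c \in D -> gap c x = 0].

Definition vertex : V := lattice_point (fun _ _ => 0%N).

Lemma kogan_vertexE v : kogan_vertex v -> v = vertex.
Proof.
have [w [_ wuniq]] := kogan_vertex_exists_unique R n.
move=> hv; rewrite -(wuniq _ hv); apply: wuniq; split.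
  by apply: GZ_lattice_point; split.
move=> k j hc; apply/(@eqA_lattice_point _ (SeqSub hc)) => //.
by move: (cellP (SeqSub hc)); lia.
Qed.

Lemma gap_vertex c : gap c vertex = 0.
Proof. by apply/gap_eq0/eqA_lattice_point => //; have := cellP c; lia. Qed.

Lemma GZ_vertex : GZ R n vertex.
Proof. by apply: GZ_lattice_point; split. Qed.

Lemma face_of_table_vertex D : face_of_table D vertex.
Proof. by split; [exact: GZ_vertex|move=> c _; exact: gap_vertex]. Qed.

(** A lattice point on the edge that leaves the vertex along [tail c]: among the inequalities A,
    only that of [c] becomes strict. It tests whether [c] belongs to a table. *)
Definition neighbour c : V :=
  lattice_point (fun k j => (j == ccol c) && (crow c <= k))%N.

Lemma neighbourE c : neighbour c = vertex + tail c.
Proof.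
apply/ffunP => c'; rewrite !ffunE addn0.
case: eqP => [h|_] /=; last by rewrite addn0 subr0.
case: leqP => _; last by rewrite addn0 subr0.
(* The cell bounds keep the index at most [n], so raising it by one subtracts exactly 1 despite
   truncation. *)
have hc' := cellP c'; rewrite /lambda -natrB //=; last by lia.
by congr (_%:R); lia.
Qed.

Lemma GZ_neighbour c : GZ R n (neighbour c).
Proof.
have := cellP c => hc; apply: GZ_lattice_point; split=> [j|c']; first by lia.
by have := cellP c'; lia.
Qed.

Lemma gap_neighbour c c' : (gap c' (neighbour c) = 0) <-> c' <> c.
Proof.
have := cellP c; have := cellP c' => hc' hc.
rewrite gap_eq0 eqA_lattice_point //; try lia.
split=> [h ec|h]; first by rewrite ec in h; lia.
have : crow c' <> crow c \/ ccol c' <> ccol c.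
  case: (eqVneq (crow c') (crow c)) => [e1|/eqP]; last by left.
  by right=> e2; apply: h; exact: cell_eq.
lia.
Qed.

Lemma face_of_table_neighbour D c : c \notin D -> face_of_table D (neighbour c).
Proof.
move=> cD; split; first exact: GZ_neighbour.
by move=> c' c'D; apply/gap_neighbour => e; rewrite -e c'D in cD.
Qed.

(** For [c] outside [D], the point [neighbour c] lies on the face and violates the equation A of
    [c]; hence a face imposes no equation A beyond those of its table. *)
Lemma diagram_face_of_table D : diagram (face_of_table D) = D.
Proof.
apply/setP => c; rewrite inE; apply/asboolP/idP => [h|cD x [_ hx]].
  apply/negPn/negP => /face_of_table_neighbour /h /gap_eq0.
  by rewrite gap_neighbour.
exact/gap_eq0/hx.
Qed.

Lemma face_of_tableI D D' :
  face_of_table D `&` face_of_table D' = face_of_table (D :|: D')%SET.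
Proof.
apply/seteqP; split=> x.
  move=> [[gx hD] [_ hD']]; split=> // c; rewrite inE => /orP[]; [exact: hD|exact: hD'].
by move=> [gx h]; split; split=> // c hc; apply: h; rewrite inE hc ?orbT.
Qed.

(** Up to a constant, minus the sum of the gaps over [D]. Gaps are nonnegative on the polytope, so
    this supporting functional is maximal exactly where they all vanish. *)
Definition table_form D (x : V) : R := - \sum_(c in D) lin_gap c x.

Lemma table_form_is_linear D : scalar (table_form D).
Proof.
move=> a x u; rewrite /table_form /= mulrN mulr_sumr -opprD -big_split /=.
by congr (- _); apply: eq_bigr => c _; exact: lin_gapD.
Qed.

HB.instance Definition _ D :=
  GRing.isLinear.Build R V R *%R (table_form D) (table_form_is_linear D).

Lemma face_face_of_table D : face (GZ R n) (face_of_table D).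
Proof.
pose cst := \sum_(c in D) ((crow c - 1)%N == 0%N)%:R * lam (ccol c).
have tE x : \sum_(c in D) gap c x = cst - table_form D x.
  rewrite /table_form opprK /cst -big_split /=; apply: eq_bigr => c _.
  by rewrite gapE addrC.
have ge0 x : GZ R n x -> forall c, c \in D -> 0 <= gap c x.
  by move=> gx c _; exact: gap_ge0.
exists (table_form D : {scalar V}), cst; split.
  by move=> x gx; rewrite -subr_ge0 /= -tE; apply: sumr_ge0; exact: ge0.
apply/seteqP; split=> x [gx h]; split=> //.
  by apply/esym/eqP; rewrite -subr_eq0 /= -tE big1 // => c; exact: h.
have := tE x; rewrite h subrr => /eqP.
rewrite psumr_eq0; last exact: ge0.
by move=> /allP s0 c cD; have := s0 c (mem_index_enum c); rewrite cD => /eqP.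
Qed.

(** Expand a supporting functional [f] at the vertex in gap coordinates. Its coefficients
    [f (tail c)] are nonpositive because each [neighbour c] lies in the polytope, while the gaps are
    nonnegative; so [f] attains [b] exactly where every gap with nonzero coefficient vanishes. *)
Lemma kogan_face_table F : kogan_face vertex F -> exists D, F = face_of_table D.
Proof.
move=> [[f [b [fle ->]]] /= [_ fv]].
have fx x : f x = b + \sum_c gap c x * f (tail c).
  rewrite -{1}(subrK vertex x) raddfD /= fv addrC; congr (_ + _).
  rewrite {1}(tail_decomposition (x - vertex)) raddf_sum.
  apply: eq_bigr => c _ /=; rewrite scalarZ; congr (_ * _).
  by rewrite -{2}(subrK vertex x) [in RHS]addrC gap_add gap_vertex add0r.
have ft c : f (tail c) <= 0.
  have := fle _ (GZ_neighbour c).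
  by rewrite neighbourE raddfD /= fv; lra.
exists [set c | f (tail c) != 0]%SET; apply/seteqP; split=> x [gx h]; split=> //=.
  move=> c; rewrite inE => fc.
  have /eqP : \sum_c gap c x * f (tail c) = 0 by have := fx x; rewrite h; lra.
  rewrite -oppr_eq0 -sumrN psumr_eq0 => [/allP /(_ c (mem_index_enum c))|c' _].
    by rewrite /= oppr_eq0 mulf_eq0 (negbTE fc) orbF => /eqP.
  by rewrite oppr_ge0; apply: mulr_ge0_le0 => //; exact: gap_ge0.
rewrite fx big1 ?addr0 // => c _.
case: (eqVneq (f (tail c)) 0) => [->|fc]; first by rewrite mulr0.
by rewrite h ?mul0r // inE.
Qed.

Lemma kogan_face_diagram F : kogan_face vertex F -> F = face_of_table (diagram F).
Proof. by case/kogan_face_table => D ->; rewrite diagram_face_of_table. Qed.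

(** The tails span, and there are as many of them as the dimension of the space. *)
Lemma free_tail : free [seq tail c | c <- enum {: cell n}].
Proof.
apply: (@basis_free _ _ fullv); rewrite basisEdim; apply/andP; split.
  apply/subvP => u _; rewrite (tail_decomposition u).
  apply: rpred_sum => c _; apply: rpredZ; apply: memv_span.
  by apply: map_f; rewrite mem_enum.
by rewrite size_map -cardE dimvf /dim /= muln1.
Qed.

(** The tails of the cells outside [D] are a basis of the directions of the face: each leads from
    the vertex to a neighbour on the face, and a difference of two points of the face has zero
    [lin_gap] on [D]. *)
Lemma affdim_face_of_table D : (affdim (face_of_table D) + #|D|)%N = #|{: cell n}|.
Proof.
pose s := [seq tail c | c <- enum (~: D)%SET].
have ss : affdim (face_of_table D) = size s.
  apply: (@affdim_eq _ _ _ vertex); first exact: face_of_table_vertex.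
  - move=> u /mapP[c]; rewrite mem_enum inE => cD ->.
    by rewrite -neighbourE; exact: face_of_table_neighbour.
  - apply: (@catr_free _ _ [seq tail c | c <- enum D]); rewrite -map_cat.
    suff p : perm_eq (enum {: cell n}) (enum D ++ enum (~: D)%SET).
      by rewrite -(perm_free (perm_map _ p)); exact: free_tail.
    rewrite uniq_perm ?enum_uniq // => [|c].
      rewrite cat_uniq !enum_uniq andbT /=; apply/hasPn => c.
      by rewrite !mem_enum inE.
    by rewrite mem_cat !mem_enum !inE orbN.
  - move=> x u [_ hx] [_ hxu]; rewrite (tail_decomposition u).
    apply: rpred_sum => c _; case: (boolP (c \in D)) => cD.
      have := hxu c cD; rewrite gap_add hx // add0r => ->.
      by rewrite scale0r mem0v.
    apply: rpredZ; apply: memv_span.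
    by apply: map_f; rewrite mem_enum inE.
by rewrite ss size_map -cardE addnC cardsC.
Qed.

End KoganFaces.

Arguments face_of_table R {n} D.
Arguments lattice_point R n u : clear implicits.
Arguments vertex R n : clear implicits.

(** * Combinatorial mitosis when column [i + 1] is empty *)

Section CombinatorialMitosis.
Variables (n i : nat).
Hypothesis i_range : (1 <= i <= n)%N.
Variable D : {set cell n}.
Hypothesis D_a1 : has_plus D 1 i.
Hypothesis D_b : forall j : nat, ~~ has_plus D j (i + 1).

(** With no plus in column [i + 1] the filter in [mit_J] keeps everything, so [mit_J] is the full
    initial run of pluses in column [i]. *)
Lemma mem_mit_J p :
  p \in mit_J D i <-> (0 < p)%N /\ (forall k, (0 < k <= p)%N -> has_plus D k i).
Proof.
pose good k := all (fun j => has_plus D j i) (iota 1 k).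
have goodP k : reflect (forall j, (0 < j <= k)%N -> has_plus D j i) (good k).
  apply: (iffP allP) => h j; first by move=> hj; apply: h; rewrite mem_iota; lia.
  by rewrite mem_iota => hj; apply: h; lia.
(* Column [i] has [n - i + 1] cells, so the bounded maximum in [mit_r] misses no run. *)
have good_le k : good k -> (k <= (n - i).+1)%N.
  case: k => // k /goodP /(_ k.+1) h.
  have /has_plusP[c _ hc] : has_plus D k.+1 i by apply: h; lia.
  by have := valP c; rewrite {1}hc mem_cells; lia.
have good_r : good (mit_r D i).
  rewrite /mit_r; elim/big_ind: _ => [//|a b ga gb|k //].
  by rewrite /maxn; case: ifP.
rewrite /mit_J mem_filter D_b /= mem_iota; split.
  move=> /andP[p0 hp]; split=> // k hk.
  by move/goodP: good_r; apply; lia.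
move=> [p0 /goodP gp]; rewrite p0 /= add1n ltnS.
have hp : (p < (n - i).+2)%N by rewrite ltnS; exact: good_le.
exact: (@leq_bigmax_cond _ _ _ (Ordinal hp)).
Qed.

(** Every row up to [p] belongs to [mit_J], so the moved and erased cells form whole column
    prefixes. *)
Lemma mit_tableE p : p \in mit_J D i ->
  mit_table D i p =
  (D :\: column_prefix n i p :|: column_prefix n (i + 1) p.-1)%SET.
Proof.
move=> /mem_mit_J[p0 hp]; apply/setP => c; rewrite !inE -/(crow c) -/(ccol c).
have hJ : (crow c < p)%N -> crow c \in mit_J D i.
  move=> h; apply/mem_mit_J; have := cellP c => hc; split=> [|k hk]; first by lia.
  by apply: hp; lia.
have e1 : ((crow c == p) || (crow c \in mit_J D i) && (crow c < p)%N) = (crow c <= p)%N.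
  by rewrite [in RHS]leq_eqVlt; congr (_ || _); case: ltnP => h; rewrite ?andbF // hJ.
have e2 : ((crow c \in mit_J D i) && (crow c < p)%N) = (crow c <= p.-1)%N.
  by rewrite -[in RHS]ltnS prednK //; case: ltnP => h; rewrite ?andbF // hJ.
by rewrite e1 e2.
Qed.

Lemma column_prefix_b_disjoint (p : nat) (c : cell n) :
  c \in column_prefix n (i + 1) p -> c \notin D.
Proof.
by rewrite inE => /andP[/eqP hc _]; have := D_b (crow c); rewrite -hc has_plus_cell.
Qed.

(* Removing [m.+1] entries of column [i] and adding [m] entries in column
   [i + 1] changes the cardinality by one only if nothing else moves. *)
Lemma comb_mitosisP D' :
  D' \in comb_mitosis D i <->
  exists m, [/\ (forall k, (k < m)%N -> has_plus D' k.+1 (i + 1)),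
                ~~ has_plus D' m.+1 (i + 1), ~~ has_plus D' 1 i,
                D :\: D' \subset column_prefix n i m.+1 & #|D'|.+1 = #|D|].
Proof.
rewrite /comb_mitosis D_a1; split.
  rewrite inE => /mapP[p hp ->]; rewrite mit_tableE //.
  have [p0 hpk] := (mem_mit_J p).1 hp.
  set A := column_prefix n i p; set B := column_prefix n (i + 1) p.-1.
  have sA : A \subset D.
    apply/fintype.subsetP => c; rewrite inE => /andP[/eqP hc hk].
    by rewrite -has_plus_cell hc; apply: hpk; have := cellP c; lia.
  have pn : (p + i <= n + 1)%N.
    have /has_plusP[c _ hc] := hpk p (introT andP (conj p0 (leqnn p))).
    by have := valP c; rewrite {1}hc mem_cells; lia.
  exists p.-1; split.
  - move=> k hk; have hc : (k.+1, (i + 1)%N) \in cells n by rewrite mem_cells; lia.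
    apply/has_plusP; exists (SeqSub hc) => //.
    by rewrite !inE /crow /ccol /=; lia.
  - apply/has_plusP => -[c]; rewrite !inE /crow /ccol => /orP[/andP[_ cD]|h] hc.
      by have := D_b p.-1.+1; rewrite /has_plus -hc valK cD.
    by move: h; rewrite hc /=; lia.
  - apply/has_plusP => -[c]; rewrite !inE /crow /ccol => h hc.
    by move: h; rewrite hc /=; lia.
  - rewrite prednK //; apply/fintype.subsetP => c; rewrite !inE negb_or negb_and negbK.
    by case/andP => /andP[/orP[//|/negbTE ->]].
  - rewrite cardsU (_ : _ :&: B = finset.set0)%SET; last first.
      apply/setP => c; rewrite inE [c \in finset.set0]inE.
      apply/negbTE/negP => /andP[/finset.setDP[cD _]].
      by move/column_prefix_b_disjoint; rewrite cD.
    rewrite cards0 subn0 cardsD (finset.setIidPr sA) !card_column_prefix //; try lia.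
    by have := subset_leq_card sA; rewrite card_column_prefix; lia.
move=> [m [hb hm ha1 sub card]].
(* If [m] is positive, the cell in row [m] of column [i + 1] exists, so column [i] reaches row
   [m.+1]. *)
have mn : (m + i <= n)%N.
  case: m hb {hm sub} => [|m] hb; first by lia.
  have /has_plusP[c _ hc] := hb m (ltnSn m).
  by have := valP c; rewrite {1}hc mem_cells; lia.
set A := column_prefix n i m.+1; set B := column_prefix n (i + 1) m.
have cA : #|A| = m.+1 by apply: card_column_prefix; lia.
have cB : #|B| = m by apply: card_column_prefix; lia.
have sB : B \subset D' :\: D.
  apply/fintype.subsetP => c cB'; rewrite inE.
  rewrite (column_prefix_b_disjoint cB') /=.
  move: cB'; rewrite inE => /andP[/eqP hc hk]; have := cellP c => h.
  rewrite -has_plus_cell hc -(@prednK (crow c)); last by lia.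
  by apply: hb; lia.
have cDD : #|D' :\: D|.+1 = #|D :\: D'|.
  have := cardsID D D'; have := cardsID D' D; rewrite finset.setIC; lia.
(* The sandwich: [D :\: D'] has at most [m.+1] elements, [D' :\: D] has at least [m], and the two
   sizes differ by one. Both inclusions are therefore equalities. *)
have leA : #|D :\: D'| <= m.+1 by rewrite -cA; exact: subset_leq_card.
have leB := subset_leq_card sB.
have eA : D :\: D' = A by apply/eqP; rewrite eqEcard sub; lia.
have eB : B = D' :\: D by apply/eqP; rewrite eqEcard sB; lia.
have hJ : m.+1 \in mit_J D i.
  apply/mem_mit_J; split=> // k hk.
  have hc : (k, i) \in cells n by rewrite mem_cells; lia.
  have : SeqSub hc \in A by rewrite inE /crow /ccol /=; lia.
  by rewrite -eA inE => /andP[_ kD]; apply/has_plusP; exists (SeqSub hc).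
rewrite inE; apply/mapP; exists m.+1 => //.
rewrite mit_tableE // -/A -/B eB -eA; apply/setP => c; rewrite !inE.
by case: (c \in D); case: (c \in D').
Qed.

End CombinatorialMitosis.

(** * Geometric mitosis in terms of tables *)

Section GeometricMitosis.
Local Open Scope ring_scope.
Variables (R : realType) (n i : nat).
Hypothesis i_range : (1 <= i <= n)%N.
Local Notation lam := (lambda R n).
Local Notation coord := Defs.coord.
Implicit Types (c : cell n) (D : {set cell n}).

Lemma a1_in_cells : (1%N, i) \in cells n.
Proof. by rewrite mem_cells; lia. Qed.

Definition a1 : cell n := SeqSub a1_in_cells.

Lemma PfaceE : Pface R n i = face_of_table R [set a1]%SET.
Proof.
apply/seteqP; split=> x [gx /= h]; split=> //.
  move=> c; rewrite inE => /eqP ->.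
  by rewrite /gap /crow /ccol /= /coord /= in h *; rewrite h subrr.
have := h a1; rewrite inE eqxx => /(_ isT) /gap_eq0.
by rewrite /eqA /crow /ccol /= => <-.
Qed.

Lemma face_of_table_inj : injective (@face_of_table R n).
Proof. by move=> D D' h; rewrite -(diagram_face_of_table R D) h diagram_face_of_table. Qed.

(** A candidate [G] contains the vertex, hence comes from a table [D']. Intersecting with [P] adds
    [a1] to it, so [D'] together with [a1] is [D]; since [G] differs from the given face, [a1] is
    missing from [D']. *)
Lemma is_expE D (G : set (gzpoint R n)) : a1 \in D ->
  is_exp (GZ R n) (Pface R n i) (face_of_table R D) G <->
  G = face_of_table R (D :\ a1)%SET.
Proof.
move=> aD; rewrite /is_exp PfaceE; split.
  move=> [fG neq GP].
  have Gv : G (vertex R n).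
    by have := @face_of_table_vertex R n D; rewrite -GP => -[].
  have eG := kogan_face_diagram (conj fG Gv); move: neq GP; rewrite {}eG.
  move: (diagram G) => D' neq; rewrite face_of_tableI => /face_of_table_inj eD.
  congr face_of_table; rewrite -eD finset.setUC finset.setU1K //.
  by apply/negP => aD'; apply: neq; rewrite -eD (finset.setUidPl _) // finset.sub1set.
move=> ->; split; first exact: face_face_of_table.
  by move=> /face_of_table_inj /setP /(_ a1); rewrite !inE eqxx aD.
by rewrite face_of_tableI finset.setUC finset.setD1K.
Qed.

Lemma admissible_face_of_table D : a1 \in D ->
  admissible (GZ R n) (Pface R n i) (face_of_table R D).
Proof.
move=> aD; split; first exact: face_face_of_table.
  rewrite PfaceE => x [gx h]; split=> // c; rewrite inE => /eqP ->; exact: h.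
exists (face_of_table R (D :\ a1)%SET); split; first exact/is_expE.
by move=> G /(is_expE _ aD).
Qed.

Lemma exp_face_of_table D : a1 \in D ->
  exp_face (GZ R n) (Pface R n i) (face_of_table R D) = face_of_table R (D :\ a1)%SET.
Proof.
move=> aD; apply/(is_expE _ aD); apply: (@xgetPex _ _ _).
by exists (face_of_table R (D :\ a1)%SET); exact/is_expE.
Qed.

Lemma has_plus_eqA D x k j :
  face_of_table R D x -> has_plus D k j -> coord x (k - 1)%N j = coord x k j.
Proof.
move=> [_ hx] /has_plusP[c cD hc]; have /gap_eq0 := hx c cD.
by rewrite /eqA /crow /ccol hc.
Qed.

(* On [Q_i] the entries of column [i] start at [lambda (i + 1)] and dominate
   those of column [i + 1], so pinning the latter pins the former. *)
Lemma Qface_forced D x m c :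
  face_of_table R D x -> Qface R n i x ->
  (forall k, (k < m)%N -> has_plus D k.+1 (i + 1)%N) ->
  ccol c = i -> (1 < crow c <= m.+1)%N -> gap c x = 0.
Proof.
move=> fx [gx qx] hb hc hk.
have colb k : (k <= m)%N -> coord x k (i + 1)%N = lam (i + 1)%N.
  elim: k => [|k IHk] km //.
  by rewrite -(has_plus_eqA fx (hb k km)) subn1 IHk //; lia.
have cola k : (0 < k <= crow c)%N -> coord x k i = lam (i + 1)%N.
  elim: k => [|[|k] IHk] kc //.
  have hcell : (k.+2, i) \in cells n.
    by have := cellP c; rewrite mem_cells; lia.
  (* Entry [k.+2] of column [i] is squeezed between the entries of row [k.+1] in columns [i] and
     [i + 1], both already equal to [lam (i + 1)]. *)
  have [] := gx _ _ hcell; rewrite subn1 /= IHk; last by lia.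
  rewrite colb; last by lia.
  by move=> h1 h2; apply/eqP; rewrite eq_le h1 h2.
by rewrite /gap hc !cola ?subrr //; lia.
Qed.

Lemma lattice_point_in_Qface (u : nat -> nat -> nat) D :
  lowering n u -> (forall c, ccol c + u (crow c) (ccol c) <= n + 1)%N -> u 1%N i = 1%N ->
  (forall c, c \in D -> u (crow c - 1)%N (ccol c) = u (crow c) (ccol c)) ->
  (face_of_table R D `&` Qface R n i) (lattice_point R n u).
Proof.
move=> hu hn u1 hD; have gu := GZ_lattice_point R hu.
split; split=> //; last first.
  by rewrite /= coord_lattice_point ?u1 ?a1_in_cells ?orbT //; exact: hu.1.
move=> c cD; apply/gap_eq0/eqA_lattice_point; rewrite ?hD //; exact: hu.1.
Qed.

(* Points of [Q_i] where exactly [a_1], [a_k0] and [b_(m.+1)], respectively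
   [a_1] and the cell [(k0, j0)], are not tight. *)
Definition lowering_ab (k0 m k j : nat) : nat :=
  if j == i then ((0 < k) + (k0 <= k))%N else if j == (i + 1)%N then nat_of_bool (m < k)%N else 0%N.

Definition lowering_aj (k0 j0 k j : nat) : nat :=
  if j == i then nat_of_bool (0 < k)%N else if j == j0 then nat_of_bool (k0 <= k)%N else 0%N.

(** Column [i] sits two steps down from row [k0] on. Interlacing then requires column [i + 1] to be
    lowered already in row [k0 - 1], which is the hypothesis [m.+1 < k0]. *)
Lemma lowering_abP k0 m : (m.+1 < k0)%N ->
  lowering n (lowering_ab k0 m) /\
  forall c, (ccol c + lowering_ab k0 m (crow c) (ccol c) <= n + 1)%N.
Proof.
move=> mk; rewrite /lowering_ab; split.
  split=> [j|c]; first by repeat (case: eqP => ?); lia.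
  have := cellP c; move: (crow c) (ccol c) => k j.
  by repeat (case: eqP => ?); lia.
move=> c; have := cellP c; move: (crow c) (ccol c) => k j.
by repeat (case: eqP => ?); lia.
Qed.

Lemma lowering_ajP k0 j0 : (0 < k0)%N -> j0 <> (i + 1)%N ->
  lowering n (lowering_aj k0 j0) /\
  forall c, (ccol c + lowering_aj k0 j0 (crow c) (ccol c) <= n + 1)%N.
Proof.
move=> k00 j0i; rewrite /lowering_aj; split.
  split=> [j|c]; first by repeat (case: eqP => ?); lia.
  have := cellP c; move: (crow c) (ccol c) => k j.
  by repeat (case: eqP => ?); lia.
move=> c; have := cellP c; move: (crow c) (ccol c) => k j.
by repeat (case: eqP => ?); lia.
Qed.

Lemma Qface_subset D D' m :
  (forall j : nat, ~~ has_plus D j (i + 1)%N) -> a1 \notin D' ->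
  (forall k, (k < m)%N -> has_plus D' k.+1 (i + 1)%N) -> ~~ has_plus D' m.+1 (i + 1)%N ->
  (face_of_table R D' `&` Qface R n i `<=` face_of_table R (D :\ a1)%SET `&` Qface R n i)
  <-> D :\: D' \subset column_prefix n i m.+1.
Proof.
move=> Db aD' hb hm; split; last first.
  move=> /fintype.subsetP sub x [fx qx]; split=> //; split; first by case: fx.
  move=> c; rewrite !inE => /andP[ca cD].
  case: (boolP (c \in D')) => cD'; first exact: fx.2.
  have := sub c; rewrite !inE cD cD' => /(_ isT) /andP[/eqP hc hk].
  apply: (Qface_forced fx qx hb hc); rewrite hk andbT ltn_neqAle.
  have := cellP c => /andP[-> _]; rewrite andbT.
  by apply/eqP => r1; move/eqP: ca; apply; apply: cell_eq.
move=> sub; apply/fintype.subsetP => c; rewrite !inE => /andP[cD' cD].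
case: (eqVneq c a1) => [->|ca]; first by rewrite eqxx.
apply/negPn/negP => hc.
have ci : ccol c <> (i + 1)%N.
  by move=> h; have := Db (crow c); rewrite -h has_plus_cell cD.
(* Any admissible lowering that respects [D'] yields a point of the smaller set, hence must be tight
   at [c]; the two choices of [u] below contradict this. *)
have key (u : nat -> nat -> nat) : lowering n u ->
    (forall c, ccol c + u (crow c) (ccol c) <= n + 1)%N -> u 1%N i = 1%N ->
    (forall c, c \in D' -> u (crow c - 1)%N (ccol c) = u (crow c) (ccol c)) ->
    u (crow c - 1)%N (ccol c) = u (crow c) (ccol c).
  move=> hu hn u1 hD'; have [[_ h] _] := sub _ (lattice_point_in_Qface hu hn u1 hD').
  have /gap_eq0 : gap c (lattice_point R n u) = 0 by apply: h; rewrite !inE ca.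
  by move/eqA_lattice_point; apply=> //; [exact: hu.1|have [_] := hu; case/(_ c)/andP].
have pc := cellP c.
have c_neq c' : c' \in D' -> crow c' <> crow c \/ ccol c' <> ccol c.
  move=> c'D; case: (eqVneq (crow c') (crow c)) => [e1|/eqP]; last by left.
  by right=> e2; move: cD'; rewrite -(cell_eq e1 e2) c'D.
have a_neq c' : c' \in D' -> crow c' <> 1%N \/ ccol c' <> i.
  move=> c'D; case: (eqVneq (crow c') 1%N) => [e1|/eqP]; last by left.
  by right=> e2; move: aD'; rewrite -(@cell_eq _ c' a1) ?c'D.
(* In column [i], use [lowering_ab]: the cells it loosens are [a1], [c] and the first cell of column
   [i + 1] missing from [D'], none of which is in [D']. *)
case: (eqVneq (ccol c) i) => [ei|ni].
  have km : (m.+1 < crow c)%N by move: hc; rewrite ei eqxx /= -ltnNge.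
  have b_neq c' : c' \in D' -> crow c' <> m.+1 \/ ccol c' <> (i + 1)%N.
    move=> c'D; case: (eqVneq (crow c') m.+1) => [e1|/eqP]; last by left.
    by right=> e2; move: hm; rewrite -e1 -e2 has_plus_cell c'D.
  have [lu nu] := lowering_abP km.
  have u1 : lowering_ab (crow c) m 1 i = 1%N.
    by rewrite /lowering_ab eqxx; move: km; clear; lia.
  suff hD' : forall c', c' \in D' -> lowering_ab (crow c) m (crow c' - 1) (ccol c') =
      lowering_ab (crow c) m (crow c') (ccol c').
    have := key _ lu nu u1 hD'; rewrite /lowering_ab ei eqxx.
    by move: km; clear; lia.
  move=> c' c'D; have := cellP c'; have := a_neq _ c'D; have := b_neq _ c'D.
  have := c_neq _ c'D; rewrite /lowering_ab ei; move: (crow c') (ccol c').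
  by clear => k j; repeat (case: eqP => ?); lia.
(* In any other column only [a1] and [c] are loosened, and neither is in [D']. *)
have [lu nu] := lowering_ajP (proj1 (andP pc)) ci.
have u1 : lowering_aj (crow c) (ccol c) 1 i = 1%N by rewrite /lowering_aj eqxx.
suff hD' : forall c', c' \in D' -> lowering_aj (crow c) (ccol c) (crow c' - 1) (ccol c') =
    lowering_aj (crow c) (ccol c) (crow c') (ccol c').
  have := key _ lu nu u1 hD'; rewrite /lowering_aj (negbTE ni) eqxx.
  by move: pc; clear; lia.
move=> c' c'D; have := cellP c'; have := a_neq _ c'D; have := c_neq _ c'D.
rewrite /lowering_aj; move: (crow c') (ccol c') (crow c) (ccol c).
by clear => k j k0 j0; repeat (case: eqP => ?); lia.
Qed.

Lemma vertex_notin_Qface : ~ Qface R n i (vertex R n).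
Proof.
move=> [_ /=]; rewrite coord_lattice_point ?a1_in_cells ?orbT //.
by move=> /eq_lambda; lia.
Qed.

Lemma face_of_table_subset_Pface D :
  (face_of_table R D `<=` Pface R n i) <-> a1 \in D.
Proof.
rewrite PfaceE; split=> [sub|aD x [gx h]].
  apply/negPn/negP => /(face_of_table_neighbour R) /sub[_ /(_ a1)].
  by rewrite inE eqxx => /(_ isT) /gap_neighbour.
by split=> // c; rewrite inE => /eqP ->; exact: h.
Qed.

Lemma GZ_mitosis_face_of_table D D' :
  has_plus D 1 i -> (forall j : nat, ~~ has_plus D j (i + 1)%N) ->
  GZ_mitosis (vertex R n) i (face_of_table R D) (face_of_table R D') <->
  D' \in comb_mitosis D i.
Proof.
move=> D1 Db; rewrite (comb_mitosisP i_range D1 Db).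
have a1E (E : {set cell n}) : has_plus E 1 i = (a1 \in E) by exact: (has_plus_cell E a1).
have aD : a1 \in D by rewrite -a1E.
have dimE : affdim (face_of_table R D') = (affdim (face_of_table R D)).+1 <->
    #|D'|.+1 = #|D|.
  have := affdim_face_of_table R D; have := affdim_face_of_table R D'; lia.
rewrite /GZ_mitosis /geom_mitosis exp_face_of_table //; split.
  move=> [_ /dimE card /face_of_table_subset_Pface/negP aD' _ sub].
  (* Row [n.+1] lies outside the table, where [has_plus] is false; the least such [m] is the length
     of the initial run of pluses in column [i + 1]. *)
  have exm : exists m, ~~ has_plus D' m.+1 (i + 1)%N.
    exists n; apply/has_plusP => -[c _ hc].
    by have := valP c; rewrite {1}hc mem_cells; lia.
  have [m hm mmin] := ex_minnP exm.
  have hb k : (k < m)%N -> has_plus D' k.+1 (i + 1)%N.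
    by move=> km; apply/negPn/negP => /mmin; rewrite leqNgt km.
  by exists m; split=> //; [rewrite a1E|exact/Qface_subset].
move=> [m [hb hm aD' sub card]]; rewrite a1E in aD'; split.
- by split; [exact: face_face_of_table|exact: face_of_table_vertex].
- exact/dimE.
- by rewrite face_of_table_subset_Pface; exact/negP.
(* The offspring cannot lie in [Q] because it contains the vertex, which is not in [Q]. *)
- by move/(_ _ (@face_of_table_vertex R n D')); exact: vertex_notin_Qface.
- exact/(Qface_subset Db aD' hb hm).
Qed.

End GeometricMitosis.

Theorem theorem4p2 (R : realType) (n i : nat) (v : gzpoint R n)
    (F : set (gzpoint R n)) :
  (1 <= n)%N -> (1 <= i <= n)%N ->
  kogan_vertex v ->
  kogan_face v F ->
  has_plus (diagram F) 1 i ->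
  (forall j : nat, ~~ has_plus (diagram F) j (i + 1)) ->
  admissible (GZ R n) (Pface R n i) F /\
  GZ_mitosis v i F =
    [set E | kogan_face v E /\ diagram E \in comb_mitosis (diagram F) i].
Proof.
move=> _ hi /kogan_vertexE -> kF; rewrite [in admissible _ _ _](kogan_face_diagram kF).
rewrite [in GZ_mitosis _ _ _](kogan_face_diagram kF).
move: (diagram F) => D D1 Db; split.
  by apply: (@admissible_face_of_table _ _ _ hi); rewrite -has_plus_cell.
have mP D' := GZ_mitosis_face_of_table R hi D' D1 Db.
apply/seteqP; split=> E /=.
  move=> mE; have kE : kogan_face (vertex R n) E by case: (mE).
  split=> //; move: mE; rewrite {1}(kogan_face_diagram kE).
  by move/mP.
move=> [kE cE]; rewrite (kogan_face_diagram kE).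
exact/mP.
Qed.
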